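(* Let $G,H$ be two graphs and $1 \in G$ a basepoint. Assume that $H$ is a uniformly locally finite median graph that is hyperbolic. If $G$ admits a biLipschitz embedding into an $\ell^1$-space, then so does the wreath product $G \wr H = (G,1) \wr H$.
   Context: Graphs are connected, identified with their vertex-sets, and viewed as metric spaces through the shortest-path metric. A graph is uniformly locally finite if there is a uniform upper bound on the degrees of its vertices; it is hyperbolic if it is Gromov-hyperbolic. In a metric space $X$, the interval between $x,y$ is $I(x,y) = \{ z \in X \mid d(x,y)=d(x,z)+d(z,y)\}$, and $X$ is median if, for all $x,y,z\in X$, the intersection $I(x,y) \cap I(y,z) \cap I(x,z)$ is a single point. A graph is a median graph if its vertex-set with the shortest-path metric is median. Wreath product of graphs: given graphs $G,H$ and a basepoint $1 \in G$, let $G^{(H)}$ denote the set of maps $\varphi : H \to G$ such that $\varphi(k)=1$ for all but finitely many $k \in H$. The wreath product $(G,1)\wr H$ is the graph whose vertices are the pairs $(\varphi,h)$ with $\varphi \in G^{(H)}$ and $h \in H$, and in which $(\varphi_1,h_1)$ and $(\varphi_2,h_2)$ are linked by an edge if either $\varphi_1=\varphi_2$ and $h_1,h_2$ are adjacent in $H$, or $h_1=h_2$ and $\varphi_1,\varphi_2$ differ only at $h_1=h_2$, with $\varphi_1(h_1),\varphi_2(h_1)$ adjacent in $G$. A biLipschitz embedding is a map $f : R \to S$ between metric spaces such that, for some $C \geq 1$, $C^{-1} d(a,b) \leq d(f(a),f(b)) \leq C d(a,b)$ for all $a,b \in R$. An $\ell^1$-space means a space $L^1(\Omega,\nu)$ for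 some measure space $(\Omega,\nu)$ (with this convention every median metric space embeds isometrically in an $\ell^1$-space). *)

(* Defs.v *)
From mathcomp Require Import all_boot all_order all_algebra.
From mathcomp Require Import all_classical all_reals all_analysis.

Set Implicit Arguments.
Unset Strict Implicit.
Unset Printing Implicit Defensive.

Import Order.TTheory GRing.Theory Num.Theory.

Local Open Scope classical_set_scope.
Local Open Scope card_scope.
Local Open Scope ring_scope.

(* [path e x p] says that x :: p is a walk, of length [size p]. *)
Definition reachable (V : Type) (e : rel V) (x y : V) : Prop :=
  exists2 p : seq V, path e x p & last x p = y.

Record graph := Graph {
  vertex :> Type;
  adj : rel vertex;
  adj_sym : symmetric adj;
  adj_irr : irreflexive adj;
  graph_connected : forall x y : vertex, reachable adj x y
}.

Definition walk_length (G : graph) (x y : G) : pred nat :=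
  fun n => `[< exists p : seq G, [/\ path (@adj G) x p, last x p = y & size p = n] >].

Lemma walk_length_ex (G : graph) (x y : G) : exists n, walk_length x y n.
Proof.
by have [p xp py] := graph_connected x y; exists (size p); apply/asboolP; exists p.
Qed.

Definition graph_dist (R : realType) (G : graph) (x y : G) : R :=
  (ex_minn (walk_length_ex x y))%:R.

Definition uniformly_locally_finite (G : graph) : Prop :=
  exists N : nat, forall x : G, [set y | adj x y] #<= `I_N.

Section MetricNotions.
Context (R : realType).

Definition interval (X : Type) (d : X -> X -> R) (x y : X) : set X :=
  [set z | d x y = d x z + d z y].

Definition median (X : Type) (d : X -> X -> R) : Prop :=
  forall x y z : X, exists m : X,
    interval d x y `&` interval d y z `&` interval d x z = [set m].

Definition gromov_product (X : Type) (d : X -> X -> R) (w x y : X) : R :=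
  (d x w + d y w - d x y) / 2.

Definition gromov_hyperbolic (X : Type) (d : X -> X -> R) : Prop :=
  exists2 delta : R, 0 <= delta & forall w x y z : X,
    Num.min (gromov_product d w x y) (gromov_product d w y z) - delta
      <= gromov_product d w x z.

Definition bilipschitz (X Y : Type) (dX : X -> X -> R) (dY : Y -> Y -> R)
    (f : X -> Y) : Prop :=
  exists2 C : R, 1 <= C & forall a b : X,
    C^-1 * dX a b <= dY (f a) (f b) /\ dY (f a) (f b) <= C * dX a b.

(* The coercion of a class f to a function picks a representative; the norm
   below does not depend on it. *)
Definition L1_dist (disp : measure_display) (T : measurableType disp)
    (mu : {measure set T -> \bar R}) (f g : LspaceType1 mu) : R :=
  fine ('N[mu]_1[EFin \o (fun t => (f t : R) - g t)%R])%E.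

Definition bilipschitz_embeds_in_L1 (X : Type) (d : X -> X -> R) : Prop :=
  exists (disp : measure_display) (T : measurableType disp)
    (mu : {measure set T -> \bar R}) (f : X -> LspaceType1 mu),
    bilipschitz d (@L1_dist disp T mu) f.

End MetricNotions.

Definition median_graph (R : realType) (G : graph) : Prop :=
  median (@graph_dist R G).

Definition hyperbolic_graph (R : realType) (G : graph) : Prop :=
  gromov_hyperbolic (@graph_dist R G).

Section Wreath.
Context (G : graph) (one : G) (H : graph).

Record finsupp_map := FinsuppMap {
  finsupp_fun :> H -> G;
  finsuppP : finite_set [set k | finsupp_fun k <> one]
}.

Lemma finsupp_map_ext (phi psi : finsupp_map) :
  (forall k, phi k = psi k) -> phi = psi.
Proof.
case: phi psi => [p p0] [q q0] /= /funext pq.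
by case: _ / pq q0 => q0; congr FinsuppMap; exact: Prop_irrelevance.
Qed.

Definition wreath_vertex : Type := (finsupp_map * H)%type.

Definition wreath_adj : rel wreath_vertex := fun u v =>
  `[< (u.1 = v.1 /\ adj u.2 v.2) \/
      [/\ u.2 = v.2,
          forall k, k <> u.2 -> u.1 k = v.1 k
        & adj (u.1 u.2) (v.1 u.2)] >].

Lemma wreath_adj_sym : symmetric wreath_adj.
Proof.
suff W u v : wreath_adj u v -> wreath_adj v u.
  by move=> u v; apply/idP/idP; exact: W.
move=> /asboolP[[uv1 uv2]|[uv1 uv2 uv3]]; apply/asboolP.
  by left; rewrite adj_sym.
right; split=> [//|k|]; first by rewrite -uv1 => /uv2.
by rewrite -uv1 adj_sym.
Qed.

Lemma wreath_adj_irr : irreflexive wreath_adj.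
Proof.
by move=> u; apply/asboolP => -[[_]|[_ _]]; rewrite adj_irr.
Qed.

Lemma reachable_trans (V : Type) (e : rel V) (x y z : V) :
  reachable e x y -> reachable e y z -> reachable e x z.
Proof.
move=> [p xp <-] [q yq <-]; exists (p ++ q); last by rewrite last_cat.
by rewrite cat_path xp.
Qed.

Lemma wreath_reach_move (phi : finsupp_map) (h k : H) :
  reachable wreath_adj (phi, h) (phi, k).
Proof.
have [p] := graph_connected h k.
elim: p h => [h _ /= ->|h' p IH h /= /andP[hh' h'p] pk]; first by exists [::].
apply: (@reachable_trans _ _ _ (phi, h')); last exact: IH.
by exists [:: (phi, h')] => //=; rewrite andbT; apply/asboolP; left.
Qed.

Definition upd (phi : H -> G) (h : H) (g : G) : H -> G :=
  fun k => if `[< k = h >] then g else phi k.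

Lemma upd_finsupp (phi : finsupp_map) (h : H) (g : G) :
  finite_set [set k | upd phi h g k <> one].
Proof.
apply: (@sub_finite_set _ _ ([set k | phi k <> one] `|` [set h])).
  by move=> k /=; rewrite /upd; case: asboolP => [->|_]; [right|left].
by rewrite finite_setU; split; [exact: finsuppP|exact: finite_set1].
Qed.

Definition lamp_upd (phi : finsupp_map) (h : H) (g : G) : finsupp_map :=
  FinsuppMap (upd_finsupp phi h g).

Lemma wreath_reach_lamp (phi psi : finsupp_map) (h : H) :
  (forall k, k <> h -> phi k = psi k) ->
  reachable wreath_adj (phi, h) (psi, h).
Proof.
have [p] := graph_connected (phi h) (psi h).
elim: p phi => [phi _ /= e|g p IH phi /= /andP[pg gp] gq] phipsi.
  exists [::] => //=; congr (_, _); apply: finsupp_map_ext => k.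
  by have [->|/phipsi] := pselect (k = h).
pose phi' := lamp_upd phi h g.
have phi'h : phi' h = g by rewrite /= /upd asboolT.
have phi'k k : k <> h -> phi' k = phi k.
  by move=> kh; rewrite /= /upd asboolF.
apply: (@reachable_trans _ _ _ (phi', h)).
  exists [:: (phi', h)] => //=; rewrite andbT; apply/asboolP; right.
  by split=> [//|k kh|]; [exact/esym/phi'k|rewrite [X in adj _ X]phi'h].
apply: IH; rewrite ?phi'h// => k kh.
by rewrite phi'k// phipsi.
Qed.

Lemma wreath_connected (u v : wreath_vertex) : reachable wreath_adj u v.
Proof.
case: u v => [phi h] [psi k].
have [s Ds] : exists s : seq {classic H},
    forall x, phi x <> psi x -> x \in s.
  have /(@finite_seqP {classic H}) [s sE] :
      finite_set [set x | phi x <> psi x].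
    apply: (@sub_finite_set _ _
      ([set x | phi x <> one] `|` [set x | psi x <> one])).
      move=> x /= xphi; have [e|] := pselect (phi x = one); last by left.
      by right=> e'; apply: xphi; rewrite e e'.
    by rewrite finite_setU; split; exact: finsuppP.
  by exists s => x xD; have : [set` s] x by rewrite -sE.
apply: (@reachable_trans _ _ _ (psi, h)); last exact: wreath_reach_move.
elim: s phi Ds => [|a s IH] phi Ds.
  suff -> : phi = psi by exists [::].
  by apply: finsupp_map_ext => x; apply: contrapT => /Ds.
pose phi' := lamp_upd phi a (psi a).
apply: (@reachable_trans _ _ _ (phi, a)); first exact: wreath_reach_move.
apply: (@reachable_trans _ _ _ (phi', a)).
  by apply: wreath_reach_lamp => x xa; rewrite /= /upd asboolF.
apply: (@reachable_trans _ _ _ (phi', h)); first exact: wreath_reach_move.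
apply: IH => x; rewrite /= /upd; case: asboolP => [->//|xa /Ds].
by rewrite (@in_cons {classic H}) => /orP[/eqP|].
Qed.

Definition wreath : graph :=
  Graph wreath_adj_sym wreath_adj_irr wreath_connected.

End Wreath.

(* Main.v *)
From HB Require Import structures.
Require Import Defs.
From mathcomp Require Import all_boot all_order all_algebra.
From mathcomp Require Import all_classical all_reals all_analysis.
From mathcomp Require Import measurable_realfun zify lra.

(* A wall of [H] is a convex set with convex complement (a halfspace, so that
   every hyperplane yields two walls).  A wall separates the
   set [S] formed by the lamplighter positions [h], [h'] and the sites where
   [phi] and [psi] differ iff the pairs (side of the lamplighter, lamps on the
   other side) of [(phi, h)] and [(psi, h')] are distinct.  Counting such walls
   is therefore a sum of discrete metrics, which embeds in L1, and one adds to
   it the direct sum over [k : H] of the given embedding of [G] applied to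
   [phi k].  Adjacent vertices of [H] are separated by exactly two walls, so the
   map is Lipschitz.

   For the lower bound, the union [K] of the intervals from [h] to the points of
   [S] supports a closed walk through [S] of length at most [2 #|K|], so it is
   enough that [#|K|] is at most linear in the number of walls separating [S].
   Given [v <> h], let [w_i] be the neighbours of [v] between [h] and [v], and
   [x_i] the gate of [h] in the halfspace [side v w_i].  Choose [j] with
   [d(v, x_j)] minimal.  By the four-point condition, the median of [v], [x_i]
   and [x_j] is within [delta] of [x_j] for all [i].  A wall between [v] and
   [x_j] contains some [side v w_i], hence also separates [x_j] from the i-th
   median, so [d(v, x_j)] is at most the degree bound times [delta].  Thus [v]
   lies in a ball of fixed radius around the gate of [h] in a halfspace that is
   bounded by a wall separating [h] from [v]. *)

Set Implicit Arguments.
Unset Strict Implicit.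
Unset Printing Implicit Defensive.

Import Order.TTheory GRing.Theory Num.Theory.

Local Open Scope classical_set_scope.

(** * Direct sums of L1 spaces *)

(* An alias, since the product sigma-algebra and product measures would require
   [T] to be sigma-finite and [I] to be countable. *)
Definition slices (I T : Type) : Type := (I * T)%type.

HB.instance Definition _ (I T : pointedType) := Pointed.on (slices I T).

Definition slice (I T : Type) (i : I) (A : set (slices I T)) : set T :=
  [set t | A (i, t)].

(** * Disjoint unions of measure spaces *)

Section SlicesMeasurable.
Context (I : pointedType) (d : measure_display) (T : measurableType d).

Definition slices_measurable : set (set (slices I T)) :=
  [set A | forall i, measurable (slice i A)].

Let slices0 : slices_measurable set0.
Proof. by move=> i; exact: measurable0. Qed.

Let slicesC A : slices_measurable A -> slices_measurable (~` A).
Proof. by move=> mA i; exact: (measurableC (mA i)). Qed.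

Let slices_bigcup (F : (set (slices I T))^nat) :
  (forall k, slices_measurable (F k)) -> slices_measurable (\bigcup_k F k).
Proof.
move=> mF i.
by apply: (@bigcupT_measurable _ T (fun k => slice i (F k))) => k; exact: mF.
Qed.

HB.instance Definition _ :=
  isMeasurable.Build d (slices I T) slices0 slicesC slices_bigcup.

Lemma measurable_slicesE (A : set (slices I T)) :
  measurable A = (forall i, measurable (slice i A)).
Proof. by []. Qed.

Lemma measurable_fun_slices d' (T' : measurableType d') (f : slices I T -> T') :
  (forall i, measurable_fun setT (fun t => f (i, t))) -> measurable_fun setT f.
Proof.
move=> mf _ Y mY; rewrite setTI measurable_slicesE => i.
by have := mf i measurableT Y mY; rewrite setTI.
Qed.

Lemma measurable_inj_slice (i : I) :
  measurable_fun setT (fun t : T => (i, t) : slices I T).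
Proof.
by move=> _ A mA; rewrite setTI; move: mA; rewrite measurable_slicesE; exact.
Qed.

Local Open Scope ring_scope.
Variables (R : realType) (mu : I -> {measure set T -> \bar R}).
Local Open Scope ereal_scope.

(** The direct sum of the measures; [\esum] is a supremum of finite subsums, so [I] may be
    uncountable. *)
Definition slices_measure (A : set (slices I T)) : \bar R :=
  \esum_(i in [set: I]) mu i (slice i A).

Let smeas0 : slices_measure set0 = 0.
Proof. by apply: esum1 => i _; rewrite measure0. Qed.

Let smeas_ge0 A : 0 <= slices_measure A.
Proof. by apply: esum_ge0 => i _; exact: measure_ge0. Qed.

Let smeas_sigma_additive : semi_sigma_additive slices_measure.
Proof.
move=> F mF tF mUF.
suff -> : slices_measure (\bigcup_n F n) = \sum_(k <oo) slices_measure (F k).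
  by apply: is_cvg_nneseries => n _ _; exact: smeas_ge0.
transitivity (\esum_(i in [set: I])
    \esum_(k in [set: nat]) mu i (slice i (F k))).
  apply: eq_esum => i _.
  rewrite -nneseries_esumT; last by move=> k; exact: measure_ge0.
  apply: (@measure_semi_bigcup _ _ _ (mu i) (fun k => slice i (F k))).
  - by move=> k; have := mF k; rewrite measurable_slicesE.
  - apply/trivIsetP => a b _ _ ab; apply/seteqP; split => // t [/= Fat Fbt].
    move/trivIsetP : tF => /(_ a b Logic.I Logic.I ab)/seteqP[+ _].
    by move=> /(_ (i, t)); apply.
  - by move: mUF; rewrite measurable_slicesE => /(_ i).
rewrite nneseries_esumT; last by move=> k; exact: smeas_ge0.
rewrite /slices_measure !esum_esum //.
rewrite (reindex_esum ([set: I] `*`` (fun=> [set: nat])) _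
  (fun k => (k.2, k.1))) //.
split => //; first by move=> [a b] [c e] _ _ /= [-> ->].
by move=> [a b] _; exists (b, a).
Qed.

HB.instance Definition _ := isMeasure.Build d (slices I T) R slices_measure
  smeas0 smeas_ge0 smeas_sigma_additive.

(** On subsets of the i-th slice the direct sum measure is the pushforward of [mu i] under the
    inclusion of that slice. *)
Lemma ge0_integral_slice (i : I) (g : slices I T -> \bar R) :
  measurable_fun [set: slices I T] g -> (forall x, 0 <= g x) ->
  \int[slices_measure]_(x in [set x | x.1 = i]) g x = \int[mu i]_t g (i, t).
Proof.
move=> mg g0.
have mS : measurable [set x : slices I T | x.1 = i].
  rewrite measurable_slicesE => j; have [->|ij] := pselect (j = i).
    by rewrite (_ : slice _ _ = setT) //; apply/seteqP.
  by rewrite (_ : slice _ _ = set0) //; apply/seteqP; split.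
pose phi (t : T) : slices I T := (i, t).
have mphi : measurable_fun setT phi by exact: measurable_inj_slice.
rewrite (@eq_measure_integral _ _ _ _ (pushforward (mu i) phi)); last first.
  move=> A mA AD; rewrite /slices_measure /pushforward.
  transitivity (\esum_(j in [set i]) mu j (slice j A)).
    2: by rewrite esum_set1.
  rewrite [RHS]esum_mkcond; apply: eq_esum => j _; rewrite /=.
  case: ifPn => // /negP ji; rewrite (_ : slice j A = set0) ?measure0 //.
  apply/seteqP; split => // t /AD/= ji'; apply: ji; exact/mem_set.
rewrite (ge0_integral_pushforward mphi) //.
- by rewrite (_ : _ @^-1` _ = setT) //; apply/seteqP.
- exact: measurable_funTS.
Qed.

Lemma ge0_integral_slices (s : seq I) (g : slices I T -> \bar R) :
  uniq s -> measurable_fun [set: slices I T] g -> (forall x, 0 <= g x) ->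
  (forall i t, i \notin s -> g (i, t) = 0) ->
  \int[slices_measure]_x g x = \sum_(i <- s) \int[mu i]_t g (i, t).
Proof.
move=> us mg g0 gs.
pose S i := [set x : slices I T | x.1 = i].
have mS i : measurable (S i).
  rewrite measurable_slicesE => j; have [->|ij] := pselect (j = i).
    by rewrite (_ : slice _ _ = setT) //; apply/seteqP.
  by rewrite (_ : slice _ _ = set0) //; apply/seteqP; split.
under [RHS]eq_bigr => i _ do rewrite -ge0_integral_slice//.
rewrite -(@ge0_integral_bigsetU _ _ _ slices_measure I S g s) //.
- rewrite [RHS]integral_mkcond; apply: eq_integral => -[i t] _.
  rewrite patchE; case: ifPn => // /negP nD; apply: gs; apply/negP => is_.
  by apply: nD; rewrite inE -bigcup_seq; exists i.
- apply/trivIsetP => a b _ _ /eqP ab; apply/seteqP; split => // x [/= xa xb].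
  by apply: ab; rewrite -xa.
- exact: measurable_funTS.
Qed.

End SlicesMeasurable.

(** * Integrable functions and their classes in L1 *)

Section LspaceType1_of_function.
Local Open Scope ring_scope.
Context (R : realType) (d : measure_display) (T : measurableType d).
Variable mu : {measure set T -> \bar R}.

Lemma measurable_mfun_mu (q : {mfun_ mu, T >-> measurableTypeR R}) :
  measurable_fun setT (q : T -> R).
Proof.
have mq : measurable_fun setT (repr q : T -> measurableTypeR R) by [].
exact: mq.
Qed.

(** The representative picked by the coercion agrees with [f] only almost everywhere, hence the form
    of the conclusion. *)
Lemma LspaceType1_of_fun (f : T -> R) :
  mu.-integrable setT (EFin \o f) ->
  exists F : LspaceType1 mu, ae_eq mu setT (F : T -> R) f.
Proof.
move=> intf.
have mf : measurable_fun setT f.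
  by apply/measurable_EFinP; exact: measurable_int intf.
have mfR : measurable_fun setT (f : T -> measurableTypeR R) by exact: mf.
pose g : {mfun T >-> measurableTypeR R} :=
  HB.pack (f : T -> measurableTypeR R) (isMeasurableFun.Build _ _ _ _ _ mfR).
pose q : {mfun_ mu, T >-> measurableTypeR R} := \pi_(_)%qT g.
have qf : ae_eq mu setT (q : T -> R) f.
  have /asboolP : ae_eq_op mu (repr q) g by rewrite -eqmodE reprK.
  by apply: filterS => x /=.
have fq : finite_norm mu 1 (q : T -> R).
  rewrite /finite_norm Lnorm1.
  rewrite (_ : (\int[mu]_x _)%E = \int[mu]_x `|(f x)%:E|)%E; last first.
    apply: ae_eq_integral => //.
    - apply: measurableT_comp => //; apply/measurable_EFinP.
      exact: measurable_mfun_mu.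
    - by apply: measurableT_comp => //; apply/measurable_EFinP.
    - by apply: filterS qf => x /= e xT; rewrite e.
  by move/integrableP : intf => [].
pose F : LspaceType1 mu := HB.pack q
  (isFinLebesgue.Build _ _ _ mu 1%E (@lexx _ _ 1%E) q fq).
by exists F.
Qed.

Lemma LspaceType1_integrable (F : LspaceType1 mu) :
  mu.-integrable setT (EFin \o (F : T -> R)).
Proof.
apply/integrableP; split.
  by apply/measurable_EFinP; exact: measurable_mfun_mu.
by have := @Lebesgue_finite _ _ _ _ _ _ F; rewrite /finite_norm Lnorm1.
Qed.

Lemma L1_distE (F G : LspaceType1 mu) (f g : T -> R) :
  ae_eq mu setT (F : T -> R) f -> ae_eq mu setT (G : T -> R) g ->
  measurable_fun setT f -> measurable_fun setT g ->
  L1_dist F G = fine (\int[mu]_x `|(f x - g x)%:E|)%E.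
Proof.
move=> Ff Gg mf mg; rewrite /L1_dist Lnorm1; congr fine.
have mL (K : LspaceType1 mu) : measurable_fun setT (K : T -> R).
  by apply/measurable_EFinP; exact: measurable_int (LspaceType1_integrable K).
apply: ae_eq_integral => //.
- apply: measurableT_comp => //; apply/measurable_EFinP.
  by apply: measurable_funB; exact: mL.
- apply: measurableT_comp => //; apply/measurable_EFinP.
  exact: measurable_funB.
- by apply: filterS2 Ff Gg => x /= e1 e2 xT; rewrite e1 ?e2.
Qed.

End LspaceType1_of_function.

(** * Direct sums of L1 embeddings and of discrete metrics *)

Section L1DirectSum.
Context (R : realType).
Local Open Scope ring_scope.

Lemma L1_dist_xx (d : measure_display) (T : measurableType d)
    (mu : {measure set T -> \bar R}) (F : LspaceType1 mu) : L1_dist F F = 0.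
Proof.
have mF : measurable_fun setT (F : T -> R) by exact: measurable_mfun_mu.
rewrite (@L1_distE _ _ _ _ F F F F) //; try exact: ae_eq_refl.
by rewrite integral0_eq //= => x _; rewrite subrr normr0.
Qed.

Lemma L1_dist_ge0 (d : measure_display) (T : measurableType d)
    (mu : {measure set T -> \bar R}) (F G : LspaceType1 mu) : 0 <= L1_dist F G.
Proof. by rewrite /L1_dist fine_ge0 ?Lnorm_ge0. Qed.

Lemma L1_dist_triangle (d : measure_display) (T : measurableType d)
    (mu : {measure set T -> \bar R}) (F G K : LspaceType1 mu) :
  L1_dist F K <= L1_dist F G + L1_dist G K.
Proof.
have intB (P Q : LspaceType1 mu) :
    mu.-integrable setT (fun x => `|((P : T -> R) x - (Q : T -> R) x)%:E|%E).
  apply: integrable_abse; rewrite (_ : (fun _ => _) =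
      (EFin \o (P : T -> R)) \- (EFin \o (Q : T -> R)))%E //.
  by apply: integrableB => //; exact: LspaceType1_integrable.
have finB (P Q : LspaceType1 mu) :
    (\int[mu]_x `|((P : T -> R) x - (Q : T -> R) x)%:E| \is a fin_num)%E.
  by apply: integrable_fin_num.
rewrite /L1_dist !Lnorm1 -fineD; [|exact: finB|exact: finB].
apply: fine_le.
- exact: finB.
- by rewrite fin_numD; apply/andP; split; exact: finB.
rewrite -ge0_integralD //; last 2 first.
- exact: measurable_int (intB F G).
- exact: measurable_int (intB G K).
apply: ge0_le_integral => //.
- exact: measurable_int (intB F K).
- by apply: emeasurable_funD; [exact: measurable_int (intB F G)|
                               exact: measurable_int (intB G K)].
- by move=> x _; rewrite lee_fin ler_distD.
Qed.

(** Finitely many nonzero components glue to a function on the disjoint union, integrable because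
    its norm is a finite sum. The list [s] may be any one that covers the indices where the two
    families differ. *)
Lemma L1_direct_sum (I : pointedType) (d : measure_display)
    (T : measurableType d) (mu : I -> {measure set T -> \bar R})
    (X : Type) (F : X -> I -> T -> R) :
  (forall x i, (mu i).-integrable setT (EFin \o F x i)) ->
  (forall x, exists s : seq I, forall i, i \notin s -> F x i = cst 0) ->
  exists (d' : measure_display) (T' : measurableType d')
    (mu' : {measure set T' -> \bar R}) (f : X -> LspaceType1 mu'),
  forall x y (s : seq I), uniq s -> (forall i, i \notin s -> F x i = F y i) ->
  L1_dist (f x) (f y) =
    \sum_(i <- s) fine (\int[mu i]_t `|(F x i t - F y i t)%:E|)%E.
Proof.
move=> intF suppF.
pose Phi x (u : slices I T) : R := F x u.1 u.2.
pose nu : {measure set (slices I T) -> \bar R} := slices_measure mu.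
have mPhi x : measurable_fun setT (Phi x).
  apply: measurable_fun_slices => i; apply/measurable_EFinP.
  exact: measurable_int (intF x i).
have intPhi x : nu.-integrable setT (EFin \o Phi x).
  apply/integrableP; split; first exact/measurable_EFinP.
  have [s Fs] := suppF x.
  rewrite (@ge0_integral_slices _ _ _ _ _ (undup s)) ?undup_uniq //;
    last 2 first.
  - by apply: measurableT_comp => //; exact/measurable_EFinP.
  - move=> i t; rewrite mem_undup => /Fs /(congr1 (@^~ t)) /= e.
    by rewrite /Phi /= e normr0.
  apply: lte_sum_pinfty => i _.
  by have /integrableP[] := intF x i.
have [f fE] := choice (fun x => LspaceType1_of_fun (intPhi x)).
exists d, (slices I T), nu, f => x y s us Fs.
rewrite (L1_distE (fE x) (fE y)) //.
rewrite (@ge0_integral_slices _ _ _ _ _ s) //; last 2 first.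
- apply: measurableT_comp => //; apply/measurable_EFinP.
  exact: measurable_funB.
- by move=> i t /Fs /(congr1 (@^~ t)) e; rewrite /Phi /= e subrr normr0.
rewrite sum_fine // => i _; apply: integrable_fin_num => //.
apply: integrable_abse; rewrite (_ : (fun _ => _) =
    (EFin \o F x i) \- (EFin \o F y i))%E //.
exact: integrableB.
Qed.

(* The discrete metric on [C] is realised by Dirac masses, at the cost of a
   factor 2: the class of [x] at [q] is the atom indexed by [(q, c x q)]. *)
Lemma L1_lamps_cuts (K Q : eqType) (C X : Type) (x0 : X) (d : measure_display)
    (T : measurableType d) (mu : {measure set T -> \bar R})
    (g : X -> K -> LspaceType1 mu) (c : X -> Q -> C) :
  (forall x, exists s : seq K, forall k, k \notin s -> g x k = g x0 k) ->
  (forall x, exists s : seq Q, forall q, q \notin s -> c x q = c x0 q) ->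
  exists (d' : measure_display) (T' : measurableType d')
    (mu' : {measure set T' -> \bar R}) (f : X -> LspaceType1 mu'),
  forall x y (s1 : seq K) (s2 : seq Q), uniq s1 -> uniq s2 ->
  (forall k, k \notin s1 -> g x k = g y k) ->
  (forall q : Q, q \in s2 <-> c x q <> c y q) ->
  L1_dist (f x) (f y) =
    \sum_(k <- s1) L1_dist (g x k) (g y k) + (2 * size s2)%N%:R.
Proof.
move=> gs cs.
pose J := (K + Q * C)%type.
(* [None] only provides a default point; its component is zero. *)
pose I : pointedType := option {classic J}.
pose inK (k : K) : I := Some (inl k : {classic J}).
pose inQ (q : Q) (e : C) : I := Some (inr (q, e) : {classic J}).
pose isK (i : I) := if i is Some (inl k) then true else false.
pose nu (i : I) : {measure set T -> \bar R} :=
  if isK i then mu else dirac point.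
pose ind (x : X) (q : Q) (e : C) : R := (`[< c x q = e >])%:R.
(* Subtracting the value at [x0] leaves differences unchanged and makes all but finitely many
   components zero. *)
pose F (x : X) (i : I) : T -> R := match i with
  | Some (inl k) => fun t => (g x k : T -> R) t - (g x0 k : T -> R) t
  | Some (inr (q, e)) => cst (ind x q e - ind x0 q e)
  | None => cst 0 end.
have intF x i : (nu i).-integrable setT (EFin \o F x i).
  case: i => [[k|[q e]]|]; last 2 first.
  - exact: (@finite_measure_integrable_cst _ _ _ (dirac point)).
  - exact: (@finite_measure_integrable_cst _ _ _ (dirac point)).
  apply: (@integrableB _ _ _ mu _ _ (EFin \o (g x k : T -> R))
    (EFin \o (g x0 k : T -> R))) => //; exact: LspaceType1_integrable.
have [] := L1_direct_sum intF.
  move=> x; have [s1 gs1] := gs x; have [s2 cs2] := cs x.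
  exists (map inK s1 ++ map (fun q : Q => inQ q (c x q)) s2 ++
     map (fun q : Q => inQ q (c x0 q)) s2).
  move=> [[k|[q e]]|] //; rewrite !mem_cat !negb_or => /and3P[h1 h2 h3].
    apply/funext => t /=; rewrite gs1 ?subrr //.
    by apply/negP => ks; move/negP : h1; apply; apply/mapP; exists k.
  apply/funext => t /=; rewrite /cst /ind.
  have [qs|/cs2 ->] := boolP (q \in s2); last by rewrite subrr.
  rewrite !asboolF ?subrr // => ce.
    by move/negP : h3; apply; apply/mapP; exists q => //; rewrite ce.
  by move/negP : h2; apply; apply/mapP; exists q => //; rewrite ce.
move=> d' [T' [mu' [f fE]]]; exists d', T', mu', f => x y s1 s2 us1 us2 gs1 cs2.
(* Each [q] in [s2] contributes two atoms, one for each of its two labels, and each atom contributes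
   1. *)
rewrite (fE x y (map inK s1 ++ map (fun q : Q => inQ q (c x q)) s2 ++
     map (fun q : Q => inQ q (c y q)) s2)); last 2 first.
- rewrite !cat_uniq !map_inj_uniq; last 3 first.
  + by move=> a b [].
  + by move=> a b [].
  + by move=> a b [].
  rewrite us1 us2 /= andbT; apply/andP; split.
    apply/hasPn => i; rewrite mem_cat => /orP[] /mapP[q _ ->];
      by apply/mapP => -[].
  apply/hasPn => i /mapP[q qs ->]; apply/mapP => -[q' _ [qq' ee]].
  by move/cs2 : qs; apply; rewrite ee qq'.
- move=> [[k|[q e]]|] //; rewrite !mem_cat !negb_or => /and3P[h1 h2 h3].
    apply/funext => t /=; rewrite gs1 //.
    by apply/negP => ks; move/negP : h1; apply; apply/mapP; exists k.
  suff ie : ind x q e = ind y q e by rewrite /F /= ie.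
  rewrite /ind; have [qs|qs] := boolP (q \in s2); last first.
    by suff -> : c x q = c y q by []; apply: contrapT => /cs2; exact/negP.
  rewrite !asboolF // => ce.
    by move/negP : h3; apply; apply/mapP; exists q => //; rewrite ce.
  by move/negP : h2; apply; apply/mapP; exists q => //; rewrite ce.
rewrite !big_cat /= !big_map; congr (_ + _).
  apply: eq_bigr => k _; rewrite /L1_dist Lnorm1; congr fine.
  by apply: eq_integral => t _ /=; rewrite opprB addrA subrK.
have one (a : R) : `|a| = 1 -> fine (\int[dirac (point : T)]_t `|a%:E|)%E = 1.
  have dT : (dirac (point : T) : {measure set T -> \bar R}) setT = 1%E.
    exact: diracT.
  by move=> a1; rewrite integral_cst // dT mule1 /= a1.
rewrite mul2n -addnn natrD -sum1_size natr_sum; congr (_ + _).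
  rewrite !big_seq; apply: eq_bigr => q /cs2 cq; set e := c x q.
  apply: (one (ind x q e - ind x0 q e - (ind y q e - ind x0 q e))).
  rewrite opprB addrA subrK /ind asboolT // asboolF ?subr0 ?normr1 //.
  by move=> /esym.
rewrite !big_seq; apply: eq_bigr => q /cs2 cq; set e := c y q.
apply: (one (ind x q e - ind x0 q e - (ind y q e - ind x0 q e))).
by rewrite opprB addrA subrK /ind asboolF // asboolT // sub0r normrN1.
Qed.

End L1DirectSum.

(** * Walls in median graphs *)

HB.instance Definition _ (G : graph) := gen_eqMixin (vertex G).
HB.instance Definition _ (G : graph) := gen_choiceMixin (vertex G).

(** * The shortest-path metric with natural-number values *)

Section GraphDistance.
Context (G : graph).
Implicit Types x y z u v : G.

Definition gd x y : nat := ex_minn (walk_length_ex x y).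

Lemma gd_walk x p : path (@adj G) x p -> gd x (last x p) <= size p.
Proof.
move=> xp; rewrite /gd; case: ex_minnP => n _; apply.
by apply/asboolP; exists p.
Qed.

Lemma gd_geodesic x y :
  exists p : seq G, [/\ path (@adj G) x p, last x p = y & size p = gd x y].
Proof. by rewrite /gd; case: ex_minnP => n /asboolP. Qed.

Lemma gdxx x : gd x x = 0.
Proof. by apply/eqP; rewrite -leqn0; exact: (@gd_walk x [::]). Qed.

Lemma gd_eq0 x y : gd x y = 0 -> x = y.
Proof. by have [p [_ <- <-]] := gd_geodesic x y => /eqP/nilP ->. Qed.

Lemma gd_triangle x y z : gd x z <= gd x y + gd y z.
Proof.
have [p [xp py <-]] := gd_geodesic x y; have [q [yq qz <-]] := gd_geodesic y z.
by rewrite -size_cat -qz -py -last_cat gd_walk // cat_path xp py.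
Qed.

Lemma gdC x y : gd x y = gd y x.
Proof.
suff W a b : gd b a <= gd a b by apply/eqP; rewrite eqn_leq !W.
have [p [ap pb <-]] := gd_geodesic a b.
have ba : last b (rev (belast a p)) = a.
  by case: p ap pb => [|c p] //= _ _; rewrite rev_cons last_rcons.
have bp : path (@adj G) b (rev (belast a p)).
  rewrite -pb rev_path (eq_path (e' := @adj G)) // => c e; exact: adj_sym.
by have := gd_walk bp; rewrite ba size_rev size_belast.
Qed.

Lemma gd_adj x y : adj x y -> gd x y = 1.
Proof.
move=> xy; apply/eqP; rewrite eqn_leq (@gd_walk x [:: y]) /= ?xy //.
rewrite lt0n; apply/eqP => /gd_eq0 e; by move: xy; rewrite e adj_irr.
Qed.

Lemma gd_step x y n : gd x y = n.+1 -> exists2 z, adj x z & gd z y = n.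
Proof.
move=> xyn; have [[|z p] [/= xp py]] := gd_geodesic x y; rewrite xyn //.
move=> -[pn].
move: xp => /andP[xz zp]; exists z => //; apply/eqP; rewrite eqn_leq.
have := gd_walk zp; rewrite py pn => -> /=.
by rewrite -ltnS -xyn -add1n -(gd_adj xz) gd_triangle.
Qed.

End GraphDistance.

Lemma seq_argmin (T : eqType) (f : T -> nat) (s : seq T) (a : T) : a \in s ->
  exists2 b, b \in s & forall c, c \in s -> f b <= f c.
Proof.
move=> as_.
have ex : exists n, n \in map f s by exists (f a); exact: map_f.
case: (ex_minnP ex) => n /mapP[b bs ->] bmin; exists b => // c cs.
by apply: bmin; exact: map_f.
Qed.

(** * Halfspaces, gates and hyperbolicity in median graphs *)

Section MedianGraph.
Context (G : graph).
Implicit Types x y z u v : G.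
Implicit Type A : set G.

Definition between x z y := gd x y = gd x z + gd z y.

Hypothesis med : forall x y z, exists m : G,
  [/\ between x m y, between y m z & between x m z].
Hypothesis medU : forall x y z m m' : G,
  between x m y -> between y m z -> between x m z ->
  between x m' y -> between y m' z -> between x m' z -> m = m'.

(** Median graphs are bipartite: the median of [z], [u], [v] is an endpoint of the edge, and that
    endpoint lies between [z] and the other one. *)
Lemma gd_adj_neq u v z : adj u v -> gd z u <> gd z v.
Proof.
move=> uv; have [m [h1 h2 h3]] := med z u v.
have := gd_adj uv; move: h1 h2 h3; rewrite /between => h1 h2 h3 h4 h5.
have [e|e] := posnP (gd u m).
  by rewrite -(gd_eq0 e) in h1 h2 h3; lia.
have e' : gd m v = 0 by lia.
by rewrite (gd_eq0 e') in h1 h2 h3; have := gdC v u; lia.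
Qed.

Definition side u v : set G := [set z | gd z u < gd z v].

Lemma sideC u v : adj u v -> ~` side u v = side v u.
Proof.
move=> uv; apply/seteqP; split => z; rewrite /side /=;
  by have := @gd_adj_neq u v z uv; lia.
Qed.

Definition convex A :=
  forall x y z, A x -> A y -> between x z y -> A z.

Lemma side_adj u v z : adj u v -> side u v z -> gd z v = (gd z u).+1.
Proof.
move=> uv; rewrite /side /= => h.
by have := gd_triangle z u v; rewrite (gd_adj uv); lia.
Qed.

Lemma convex_side u v : adj u v -> convex (side u v).
Proof.
move=> uv x y z xA yA xzy; rewrite /side /=.
apply: contrapT => /negP; rewrite -leqNgt leq_eqVlt => /orP[/eqP e|zv].
  by have := @gd_adj_neq u v z uv; rewrite e.
have vu : adj v u by rewrite adj_sym.
have {}zv := side_adj vu zv.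
have {}xA := side_adj uv xA; have {}yA := side_adj uv yA.
have [p [xpz zpu xpu]] := med x z u; have [q [yqz zqu yqu]] := med y z u.
rewrite /between in xzy xpz zpu xpu yqz zqu yqu.
(* If [z] were closer to [v], then [p], [z], [q] and [r := m(p, q, u)] would form
   a rectangle with [z] opposite to [r], while the neighbour [s] of [p] towards
   [v] would lie on the way from [p] to both [z] and [r]. *)
have [r [prq qru pru]] := med p q u.
rewrite /between in prq qru pru.
have uv1 := gd_adj uv.
have pv : gd p v = (gd p u).+1.
  have := gd_triangle p u v; have := gd_triangle x p v; lia.
have qv : gd q v = (gd q u).+1.
  have := gd_triangle q u v; have := gd_triangle y q v; lia.
have pzq : gd p q = gd p z + gd z q.
  have := gd_triangle p z q; have := gd_triangle x p y.
  have := gd_triangle p q y.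
  by rewrite (gdC z y) in xzy; rewrite (gdC z q) (gdC q y); lia.
have zr1 : gd z r = gd z p + gd p r.
  have := gd_triangle z p r; have := gd_triangle z r u; lia.
have zr2 : gd z r = gd z q + gd q r.
  have := gd_triangle z q r; have := gd_triangle z r u; lia.
have rv : gd r v = (gd r u).+1.
  have := gd_triangle r u v; have := gd_triangle p r v; lia.
have [s [psz zsv psv]] := med p z v; have [s' [qsz zsv' qsv]] := med q z v.
rewrite /between in psz zsv psv qsz zsv' qsv.
(* As [z] is closer to [v] and [p] to [u], the sum [gd p z + gd p v] exceeds [gd z v] by 2, which is
   twice [gd p s]. *)
have ps1 : gd p s = 1 by move: (gdC z p) (gdC z s); lia.
have qs1 : gd q s' = 1 by move: (gdC z q) (gdC z s'); lia.
have [t [sts s'tv stv]] := med s s' v.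
rewrite /between in sts s'tv stv.
have ss : gd s s' + 2 = gd p q.
  move: (gd_triangle s z s') (gd_triangle p s q) (gd_triangle s s' q).
  by move: (gdC z q) (gdC z s') (gdC s' q); lia.
have tv : gd t v = gd r v.
  by move: (gdC t s') (gdC r q); lia.
have st : (gd s t).+1 = gd p r.
  by move: (gdC t s') (gdC r q); lia.
have s't : (gd s' t).+1 = gd q r.
  by move: (gdC t s') (gdC r q); lia.
have tr : t = r.
  have := gd_triangle p s t; have := gd_triangle q s' t.
  have := gd_triangle p t q; have := gdC t q; have := gdC r q => a1 a2 a3 a4 a5.
  have pt : gd p t = gd p r by lia.
  have qt : gd q t = gd q r by lia.
  by apply: (@medU p q v); rewrite /between //; lia.
(* The route through [s] saves one step towards [z] and one towards [r], against [zr1]. *)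
have := gd_triangle z s r; move: (gdC z p) (gdC z s).
by move: st; rewrite tr; lia.
Qed.

Definition wall A := convex A /\ convex (~` A).

Lemma wall_side u v : adj u v -> wall (side u v).
Proof.
move=> uv; split; first exact: convex_side.
by rewrite sideC //; apply: convex_side; rewrite adj_sym.
Qed.

(** A crossed edge determines the wall: if [z] is closer to [u] but outside [A], then [u] lies
    between the points [z] and [v] of the convex complement. The other inclusion is symmetric. *)
Lemma wall_edge A u v : wall A -> adj u v -> A u -> ~ A v -> A = side u v.
Proof.
move=> [cA cCA] uv Au Av.
have sub z : side u v z -> A z.
  move=> h; apply: contrapT => Az; apply: (cCA z v u Az Av _ Au).
  by rewrite /between (gd_adj uv) (side_adj uv h) addn1.
apply/seteqP; split => z; last exact: sub.
move=> Az; apply: contrapT => h.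
have {}h : side v u z by rewrite -sideC.
have vu : adj v u by rewrite adj_sym.
apply: Av; apply: (cA z u v Az Au).
by rewrite /between (gd_adj vu) (side_adj vu h) addn1.
Qed.

(** Take [p] nearest to [x] in [A]. The median of [x], [p], [b] is in [A] by convexity and lies
    between [x] and [p], so it is [p]. *)
Lemma gate_ex A x a : convex A -> A a ->
  exists2 p, A p & forall b, A b -> between x p b.
Proof.
move=> cA Aa.
have ex : exists n, `[< exists2 p, A p & gd x p = n >].
  by exists (gd x a); apply/asboolP; exists a.
case: (ex_minnP ex) => n /asboolP[p Ap pn] nmin; exists p => // b Ab.
have [m [xmp pmb xmb]] := med x p b.
suff -> : p = m by [].
have Am : A m := cA _ _ _ Ap Ab pmb.
have := nmin (gd x m) (asboolT (ex_intro2 _ _ m Am erefl)).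
rewrite -pn xmp => h; apply/esym/gd_eq0.
by lia.
Qed.

(** Induction along a geodesic: a wall containing [x] but not [y] either crosses the first edge,
    which determines it, or contains the next vertex. Fixing the orientation makes the count
    [gd x y] rather than twice that. *)
Lemma walls_between x y : exists s : seq (set G),
  [/\ uniq s, size s = gd x y &
      forall A, A \in s <-> [/\ wall A, A x & ~ A y]].
Proof.
have [n] := ubnP (gd x y); elim: n => // n IH in x *; rewrite ltnS.
case E : (gd x y) => [|m] mn.
  by exists [::]; split => // A; split => // -[_]; rewrite (gd_eq0 E).
have [z xz zy] := gd_step E.
have [|s [us ss sE]] := IH z; first by rewrite zy.
have zNs : ~ side x z z by rewrite /side /= gdxx.
have xs : side x z x by rewrite /side /= gdxx (gd_adj xz).
have ys : ~ side x z y by rewrite /side /= gdC E gdC zy; apply/negP; lia.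
exists (side x z :: s); split => /=.
- by rewrite us andbT; apply/negP => /sE[].
- by rewrite ss zy.
move=> A; rewrite inE; split.
  move=> /orP[/eqP ->|/sE[wA Az Ay]]; first by split => //; exact: wall_side.
  split => //; apply: contrapT => Ax; apply: Ay.
  have zx : adj z x by rewrite adj_sym.
  rewrite (wall_edge wA zx Az Ax) /side /=.
  by rewrite gdC zy gdC E.
move=> [wA Ax Ay]; have [Az|Az] := pselect (A z).
  by apply/orP; right; apply/sE.
by apply/orP; left; apply/eqP; exact: wall_edge.
Qed.

Definition degree_le (N : nat) := forall x, exists s : seq G,
  size s <= N /\ forall y, adj x y -> y \in s.

Lemma ball_ex (N : nat) : degree_le N -> forall r x, exists s : seq G,
  size s <= N.+1 ^ r /\ forall y, gd x y <= r -> y \in s.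
Proof.
move=> degN; elim=> [|r IH] x.
  exists [:: x]; split => // y; rewrite leqn0 => /eqP/gd_eq0 ->.
  exact: mem_head.
have [s [sr sE]] := IH x; have [nb nbE] := choice degN.
exists (flatten [seq z :: nb z | z <- s]); split.
  rewrite size_flatten /shape -map_comp expnSr.
  apply: leq_trans (leq_mul sr (leqnn _)).
  elim: s {sr sE} => //= z s IHs; rewrite mulSn leq_add // ltnS.
  by case: (nbE z).
move=> y; rewrite leq_eqVlt => /orP[/eqP xy|]; last first.
  rewrite ltnS => /sE ys; apply/flattenP; exists (y :: nb y).
    exact: map_f.
  exact: mem_head.
have [z yz zx] : exists2 z, adj y z & gd z x = r by apply: gd_step; rewrite gdC.
apply/flattenP; exists (z :: nb z).
  by apply: map_f; apply: sE; rewrite gdC zx.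
by rewrite inE; apply/orP; right; apply: (nbE z).2; rewrite adj_sym.
Qed.

Variable delta : nat.
Hypothesis hyp : forall x y z w,
  gd x y + gd z w <= maxn (gd x z + gd y w) (gd x w + gd y z) + delta.

Lemma wall_near (N : nat) (v0 v : G) : degree_le N -> v <> v0 ->
  exists A p, [/\ wall A, A v, ~ A v0, A p &
    (forall a, A a -> between v0 p a) /\ gd p v <= N * delta].
Proof.
move=> degN vv0; have [nb [nbN nbE]] := degN v.
have gateX w : exists p, adj v w -> side v w p /\
    forall b, side v w b -> between v0 p b.
  have [vw|_] := boolP (adj v w); last by exists v.
  have vA : side v w v by rewrite /side /= gdxx (gd_adj vw).
  have [p pA pE] := gate_ex v0 (convex_side vw) vA.
  by exists p.
have [X XE] := choice gateX.
pose Q := [seq w <- nb | adj v w & gd v0 v == (gd v0 w).+1].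
have QE w : adj v w -> gd v0 v = (gd v0 w).+1 -> w \in Q.
  by move=> vw e; rewrite mem_filter vw e eqxx nbE.
have Qadj w : w \in Q -> adj v w /\ gd v0 v = (gd v0 w).+1.
  by rewrite mem_filter => /andP[/andP[vw /eqP]].
have vside w : adj v w -> side v w v.
  by move=> vw; rewrite /side /= gdxx (gd_adj vw).
have [w0 w0Q] : exists w, w \in Q.
  case E : (gd v v0) => [|n]; first by have := gd_eq0 E.
  have [w vw wv0] := gd_step E; exists w; apply: QE => //.
  by rewrite gdC E gdC wv0.
have [j jQ jmin] := seq_argmin (fun w => gd v (X w)) w0Q.
have [vj vj0] := Qadj j jQ; have [Xj Xjg] := XE j vj.
exists (side v j), (X j); split => //.
- exact: wall_side.
- exact: vside.
- by rewrite /side /= vj0; apply/negP; lia.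
split => //.
have [m mE] := choice (fun w => med v (X w) (X j)).
(* Both gates lie between [v0] and [v], so the four-point condition and the choice of [j] give [gd
   (X w) (X j) + gd v (X j) <= gd v (X w) + delta]. Hence even twice [gd (m w) (X j)] is at most
   [delta]. *)
have mj w : w \in Q -> gd (m w) (X j) <= delta.
  move=> wQ; have [vw vw0] := Qadj w wQ; have [Xw Xwg] := XE w vw.
  have [] := mE w; have := jmin w wQ; have := hyp v0 v (X w) (X j).
  have := Xjg v (vside j vj); have := Xwg v (vside w vw).
  by rewrite /between (gdC (X w) (m w)) (gdC (X w) v) (gdC (X j) v); lia.
have [W WE] := choice (fun w => walls_between (m w) (X j)).
have [s [us ss sE]] := walls_between v (X j).
rewrite gdC -ss; apply: (@leq_trans (size (flatten [seq W w | w <- Q]))).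
  apply: uniq_leq_size => // A /sE[wA Av AXj].
  have Av0 : ~ A v0.
    move=> Av0; apply: AXj; apply: (wA.1 v0 v) => //; exact: Xjg (vside j vj).
  (* Let [p] be the gate of [v] in the complement of [A], and [w] a first step towards it. Points
     outside [A] are reached from [v] through [p], so they are closer to [w]; hence [side v w] is
     contained in [A]. *)
  have [p Ap pg] := gate_ex v wA.2 Av0.
  have [w vw wp] : exists2 w, adj v w & (gd w p).+1 = gd v p.
    case E : (gd v p) => [|n]; first by have := Ap; rewrite -(gd_eq0 E).
    by have [w vw <-] := gd_step E; exists w.
  have wQ : w \in Q.
    apply: QE => //; have := pg v0 Av0; rewrite /between.
    have := gd_triangle w p v0; have := gd_triangle v w v0; rewrite (gd_adj vw).
    by rewrite (gdC v0 v) (gdC v0 w); lia.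
  have sub z : side v w z -> A z.
    rewrite /side /= => zA; apply: contrapT => Az.
    have := pg z Az; rewrite /between.
    by have := gd_triangle w p z; move: zA; rewrite (gdC z v) (gdC z w); lia.
  have AXw : A (X w) by apply: sub; case: (XE w vw).
  apply/flattenP; exists (W w); first exact: map_f.
  have [_ _ WwE] := WE w; apply/WwE; split => //.
  by have [h _ _] := mE w; apply: (wA.1 v (X w)).
apply: (@leq_trans (size Q * delta)); last first.
  by rewrite leq_mul2r (leq_trans _ nbN) ?orbT // size_filter count_size.
rewrite size_flatten /shape -map_comp.
elim: Q {QE Qadj w0Q jQ jmin vj0} mj => //= w Q IH mj.
rewrite mulSn leq_add //.
  by have [_ -> _] := WE w; apply: mj; exact: mem_head.
by apply: IH => w' w'Q; apply: mj; rewrite inE w'Q orbT.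
Qed.

(** Let [v <> v0] lie between [v0] and a point [s] of [S]. The wall given by [wall_near] contains
    [v] but not [v0], hence contains [s] by convexity of its complement, so it is in [ws]. Balls of
    radius [N * delta] around the gates of [v0] in the members of [ws] therefore cover all but [v0],
    which accounts for the successor. *)
Lemma hull_card (N : nat) : degree_le N -> exists B,
  forall (v0 : G) (S : seq G) (ws : seq (set G)),
  (forall A s, wall A -> s \in S -> ~ A v0 -> A s -> A \in ws) ->
  exists K : seq G, [/\ uniq K,
    forall v, v \in K <-> v = v0 \/ exists2 s, s \in S & between v0 v s &
    size K <= (B * size ws).+1].
Proof.
move=> degN; exists (N.+1 ^ (N * delta)) => v0 S ws wsE.
have [bl blE] := choice (fun s => ball_ex degN (gd v0 s) v0).
pose K0 := undup (flatten [seq bl s | s <- S]).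
pose K := [seq v <- K0 |
  (v != v0) && `[< exists2 s, s \in S & between v0 v s >]].
have uK : uniq K by rewrite filter_uniq // undup_uniq.
have KE v : v \in K <-> v <> v0 /\ exists2 s, s \in S & between v0 v s.
  rewrite mem_filter; split.
    by move=> /andP[/andP[/eqP vv0 /asboolP h] _].
  move=> [/eqP vv0 [s sS v0vs]]; rewrite vv0 /=; apply/andP; split.
    by apply/asboolP; exists s.
  rewrite mem_undup; apply/flattenP; exists (bl s); first exact: map_f.
  by apply: (blE s).2; move: v0vs; rewrite /between; lia.
exists (v0 :: K); split.
- by rewrite /= uK andbT; apply/negP => /KE[].
- move=> v; rewrite inE; split.
    by move=> /orP[/eqP ->|/KE[_ ?]]; [left|right].
  have [->|/eqP vv0] := pselect (v = v0); first by rewrite eqxx.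
  move=> [/eqP|h]; first by rewrite (negbTE vv0).
  by apply/orP; right; apply/KE; split => //; exact/eqP.
rewrite /= ltnS.
have gateP A : exists p, wall A -> ~ A v0 -> A !=set0 -> A p /\
    forall a, A a -> between v0 p a.
  have [wA|nA] := pselect (wall A); last by exists v0 => /nA.
  have [[a Aa]|nA0] := pselect (A !=set0); last by exists v0 => _ _ /nA0.
  by have [p Ap pg] := gate_ex v0 wA.1 Aa; exists p.
have [P PE] := choice gateP.
have [bL bLE] := choice (ball_ex degN (N * delta)).
apply: (@leq_trans (size (flatten [seq bL (P A) | A <- ws]))).
  apply: uniq_leq_size => // v /KE[vv0 [s sS v0vs]].
  have [A [p [wA Av Av0 Ap [pg pv]]]] := wall_near degN vv0.
  have [APA Pg] := PE A wA Av0 (ex_intro _ v Av).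
  have pP : p = P A.
    have := pg _ APA; have := Pg _ Ap; rewrite /between (gdC p) => h1 h2.
    by apply: gd_eq0; rewrite gdC; lia.
  have As : A s.
    apply: contrapT => As; have := wA.2 v0 s v Av0 As v0vs; exact.
  apply/flattenP; exists (bL (P A)).
    by apply: map_f; apply: wsE wA sS Av0 As.
  by apply: (bLE _).2; rewrite -pP.
rewrite size_flatten /shape -map_comp mulnC.
elim: ws {wsE} => //= A ws IH; rewrite mulSn leq_add //.
exact: (bLE _).1.
Qed.

End MedianGraph.

(** * Closed walks through star-shaped vertex sets *)

Section ClosedWalk.
Context (G : graph).

(** Remove a vertex [v] farthest from [v0] and splice the detour [w], [v], [w] into a closed walk
    through the rest, where [w] is a neighbour of [v] towards [v0]. In effect the walk goes around a
    spanning tree. *)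
Lemma closed_walk (v0 : G) (K : seq G) :
  uniq K -> v0 \in K ->
  (forall u v, u \in K -> between v0 v u -> v \in K) ->
  exists p : seq G, [/\ path (@adj G) v0 p, last v0 p = v0,
    {subset K <= v0 :: p} & (size p).+2 <= 2 * size K].
Proof.
have [n] := ubnP (size K); elim: n => // n IH in K *.
rewrite ltnS => Kn uK v0K star.
have [v vK vmax] : exists2 v, v \in K & forall u, u \in K -> gd v0 u <= gd v0 v.
  have ex : exists m, m \in map (gd v0) K by exists (gd v0 v0); exact: map_f.
  have ub m : m \in map (gd v0) K -> m <= \max_(u <- K) gd v0 u.
    by move=> /mapP[u uK' ->]; exact: leq_bigmax_seq.
  case: (ex_maxnP ex ub) => m /mapP[v vK ->] mmax; exists v => // u uK'.
  by apply: mmax; exact: map_f.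
have [vv0|/eqP vv0] := pselect (v = v0).
  have Ksub u : u \in K -> u = v0.
    by move=> /vmax; rewrite vv0 gdxx leqn0 => /eqP/gd_eq0.
  exists [::]; split => //; first by move=> u /Ksub ->; exact: mem_head.
  by case: K v0K {Kn uK star vK vmax Ksub} => //= a K _; rewrite mulnS.
case E : (gd v v0) => [|m]; first by move: vv0; rewrite (gd_eq0 E) eqxx.
have [w vw wv0] := gd_step E.
have wK : w \in K.
  by apply: (star v w vK); rewrite /between gdC E gdC wv0 gdC (gd_adj vw) addn1.
have wv : w != v by apply/eqP => e; move: vw; rewrite e adj_irr.
have sK : size K = (size (rem v K)).+1.
  by rewrite size_rem // prednK //; case: K vK {Kn uK v0K star vmax wK}.
have memK u : u \in rem v K = (u != v) && (u \in K) by rewrite mem_rem_uniq.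
have [||||p [v0p pv0 Kp ps]] := IH (rem v K).
- by rewrite -ltnS -sK.
- exact: rem_uniq.
- by rewrite memK v0K andbT eq_sym.
(* The rest is still star-shaped: being farthest, [v] is not between [v0] and another vertex. *)
- move=> u u'; rewrite !memK => /andP[uv uK'] b; rewrite (star u u') // andbT.
  apply/eqP => e; rewrite e /between in b; have := vmax u uK'.
  have [/gd_eq0 vu|] := posnP (gd v u); last by lia.
  by move: uv; rewrite vu eqxx.
have wp : w \in v0 :: p by apply: Kp; rewrite memK wv.
case/splitPl : wp v0p pv0 Kp ps => p1 p2 p1w; rewrite cat_path last_cat p1w.
move=> /andP[v0p1 wp2] pv0 Kp ps; exists (p1 ++ v :: w :: p2); split.
- by rewrite cat_path v0p1 p1w /= adj_sym vw wp2.
- by rewrite last_cat.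
- move=> u uK'; have [->|uv] := eqVneq u v.
    by rewrite inE mem_cat inE eqxx !orbT.
  have := Kp u; rewrite memK uv uK' => /(_ isT).
  by rewrite !inE !mem_cat !inE => /or3P[] ->; rewrite ?orbT.
- by move: ps; rewrite sK !size_cat /=; lia.
Qed.

End ClosedWalk.

(** * Wreath products *)

Section RealToNat.
Context (R : realType) (G : graph).

Lemma graph_distE (x y : G) : graph_dist R x y = (gd x y)%:R%R.
Proof. by []. Qed.

Lemma interval_between (x y z : G) :
  Defs.interval (@graph_dist R G) x y z <-> between x z y.
Proof.
rewrite /Defs.interval /= !graph_distE -natrD /between; split => [/eqP|->//].
by rewrite eqr_nat => /eqP.
Qed.

Lemma median_graph_ex : median_graph R G -> forall x y z : G, exists m : G,
  [/\ between x m y, between y m z & between x m z].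
Proof.
move=> med x y z; have [m /seteqP[_ /(_ m erefl)[[h1 h2] h3]]] := med x y z.
by exists m; split; apply/interval_between.
Qed.

Lemma median_graph_uniq : median_graph R G -> forall x y z m m' : G,
  between x m y -> between y m z -> between x m z ->
  between x m' y -> between y m' z -> between x m' z -> m = m'.
Proof.
move=> med x y z m m' a b c a' b' c'; have [n /seteqP[sub _]] := med x y z.
have -> : m = n by apply: sub; do 2?split; exact/interval_between.
by apply/esym; apply: sub; do 2?split; exact/interval_between.
Qed.

(** With basepoint [w], clearing the halves in the Gromov products doubles the constant, which is
    then rounded up to a natural number. *)
Lemma hyperbolic_graph_four_points : hyperbolic_graph R G ->
  exists delta : nat, forall x y z w : G,
    gd x y + gd z w <= maxn (gd x z + gd y w) (gd x w + gd y z) + delta.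
Proof.
move=> [e e0 hyp]; exists (Num.bound (2 * e)%R) => x y z w.
have := archi_boundP (mulr_ge0 (ler0n R 2) e0); move: (Num.bound _) => D eD.
have := hyp w x z y; rewrite /gromov_product !graph_distE (gdC z y) => h.
rewrite addn_maxl leq_max -!(ler_nat R) !natrD; apply/orP.
by move: h; rewrite lerBlDr ge_min => /orP[h|h]; [left|right]; lra.
Qed.

End RealToNat.

(** * Routes in the wreath product and labels of walls *)

Section WreathDistance.
Context (G : graph) (one : G) (H : graph).
Local Notation W := (wreath one H).
Implicit Types phi psi : finsupp_map one H.

Lemma wreath_move_adj phi (h k : H) : adj h k ->
  @adj W (phi, h) (phi, k).
Proof. by move=> hk; apply/asboolP; left. Qed.

Lemma lamp_updE phi h (a : G) : lamp_upd phi h a h = a.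
Proof. by rewrite /= /upd asboolT. Qed.

Lemma lamp_upd_neq phi h (a : G) k : k <> h -> lamp_upd phi h a k = phi k.
Proof. by move=> kh; rewrite /= /upd asboolF. Qed.

Lemma wreath_lamp_dist phi psi (h : H) :
  (forall k, k <> h -> phi k = psi k) ->
  gd ((phi, h) : W) (psi, h) <= gd (phi h) (psi h).
Proof.
have [n] := ubnP (gd (phi h) (psi h)); elim: n => // n IH in phi *.
rewrite ltnS; case E : (gd (phi h) (psi h)) => [|m] mn phipsi.
  suff -> : phi = psi by rewrite gdxx.
  apply: finsupp_map_ext => k; have [->|/phipsi //] := pselect (k = h).
  exact: gd_eq0.
have [a pa ap] := gd_step E; pose phi' := lamp_upd phi h a.
have phi'h : phi' h = a by exact: lamp_updE.
have phi'k k : k <> h -> phi' k = phi k by exact: lamp_upd_neq.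
apply: leq_trans (gd_triangle _ ((phi', h) : W) _) _.
have -> : gd ((phi, h) : W) (phi', h) = 1.
  apply: gd_adj; apply/asboolP; right; split => // [k kh|].
    exact/esym/phi'k.
  by rewrite [X in adj _ X]phi'h.
rewrite add1n ltnS -[X in _ <= X]ap -phi'h; apply: IH.
  by rewrite phi'h ap.
by move=> k kh; rewrite phi'k // phipsi.
Qed.

(** The lamplighter follows the walk and gives each lamp its final value on first passing it. *)
Lemma wreath_walk_dist phi psi (s p : seq H) (h : H) :
  uniq s -> (forall k, phi k <> psi k -> k \in s) ->
  path (@adj H) h p -> (forall k, phi k <> psi k -> k \in h :: p) ->
  gd ((phi, h) : W) (psi, last h p) <=
    size p + \sum_(k <- s) gd (phi k) (psi k).
Proof.
move=> us; elim: p h phi => [|h' p IH] h phi phis.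
  move=> _ ph /=; rewrite add0n.
  have ph' k : k <> h -> phi k = psi k.
    by move=> kh; apply: contrapT => /ph; rewrite inE => /eqP.
  apply: leq_trans (wreath_lamp_dist ph') _.
  have [->|/phis hs] := pselect (phi h = psi h); first by rewrite gdxx.
  by rewrite (bigD1_seq h) //= leq_addr.
move=> /= /andP[hh' h'p] php.
have [phi' phi'h phi'k] : exists2 phi' : finsupp_map one H, phi' h = psi h &
    forall k, k <> h -> phi' k = phi k.
  exists (lamp_upd phi h (psi h)); first exact: lamp_updE.
  by move=> k; exact: lamp_upd_neq.
have phi'psi k : phi' k <> psi k -> phi k <> psi k /\ k <> h.
  have [->|kh] := pselect (k = h); first by rewrite phi'h.
  by rewrite phi'k.
have E : gd (phi h) (psi h) + \sum_(k <- s) gd (phi' k) (psi k)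
    <= \sum_(k <- s) gd (phi k) (psi k).
  have [e|/phis hs] := pselect (phi h = psi h).
    rewrite e gdxx add0n leq_sum // => k _.
    by have [->|/phi'k ->] := pselect (k = h); rewrite // phi'h gdxx.
  rewrite (bigD1_seq h) //= phi'h gdxx add0n [X in _ <= X](bigD1_seq h) //=.
  by rewrite leq_add2l leq_sum // => k /eqP /phi'k ->.
apply: leq_trans (gd_triangle _ ((phi', h) : W) _) _.
apply: leq_trans (leq_add (leqnn _) (gd_triangle _ ((phi', h') : W) _)) _.
have h1 : gd ((phi, h) : W) (phi', h) <= gd (phi h) (psi h).
  by rewrite -phi'h; apply: wreath_lamp_dist => k /phi'k.
have h2 : gd ((phi', h) : W) (phi', h') = 1 by exact/gd_adj/wreath_move_adj.
have h3 : gd ((phi', h') : W) (psi, last h' p) <=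
    size p + \sum_(k <- s) gd (phi' k) (psi k).
  apply: IH => // [k /phi'psi[/phis] //|k /phi'psi[/php]].
  by rewrite inE => /orP[/eqP ->|].
by lia.
Qed.

Lemma finsupp_diff phi psi :
  exists2 s : seq H, uniq s & forall k, k \in s <-> phi k <> psi k.
Proof.
have /(@finite_seqP H) [s sE] : finite_set [set x | phi x <> psi x].
  apply: (@sub_finite_set _ _
    ([set x | phi x <> one] `|` [set x | psi x <> one])).
    move=> x /= xphi; have [e|] := pselect (phi x = one); last by left.
    by right=> e'; apply: xphi; rewrite e e'.
  by rewrite finite_setU; split; exact: finsuppP.
exists (undup s) => [|k]; first exact: undup_uniq.
by rewrite mem_undup; have /seteqP[/(_ k) a /(_ k) b] := sE; split.
Qed.

(* The side of the lamplighter and the lamps of the other side; [None] hides the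
   lamps on the lamplighter's side. *)
Definition wall_label (x : W) (A : set H) : bool * (H -> option G) :=
  if `[< wall A >] then
    (`[< A x.2 >], fun k => if `[< A k >] == `[< A x.2 >] then None
                            else Some (x.1 k))
  else (false, fun=> None).

Lemma wall_label_move phi (h h' : H) (A : set H) :
  wall_label (phi, h) A <> wall_label (phi, h') A ->
  wall A /\ ((A h /\ ~ A h') \/ (A h' /\ ~ A h)).
Proof.
rewrite /wall_label; case: asboolP => wA //= ne; split => //.
have [a|a] := pselect (A h); have [b|b] := pselect (A h'); try by [left|right].
- by exfalso; apply: ne; rewrite !asboolT.
- by exfalso; apply: ne; rewrite !(asboolF (P := A _)).
Qed.

(** The lamp at the lamplighter's own position is on the lamplighter's side, hence hidden. *)
Lemma wall_label_lamp phi psi (h : H) (A : set H) :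
  (forall k, k <> h -> phi k = psi k) ->
  wall_label (phi, h) A = wall_label (psi, h) A.
Proof.
move=> phipsi; rewrite /wall_label; case: asboolP => wA //=; congr pair.
apply/funext => k; case: eqP => // ne; congr Some; apply: phipsi => kh.
by apply: ne; rewrite kh.
Qed.

Lemma wall_label_ext phi (h h' : H) psi (A : set H) :
  (A h <-> A h') -> (forall k, ~ (A k <-> A h) -> phi k = psi k) ->
  wall_label (phi, h) A = wall_label (psi, h') A.
Proof.
move=> hh' phipsi; rewrite /wall_label; case: asboolP => wA //=.
have <- : A h = A h' by exact: propext.
congr pair; apply/funext => k; case: eqP => // ne; congr Some.
by apply: phipsi => e; apply: ne; have -> : A k = A h by exact: propext.
Qed.

(** If the two lamplighters are on the same side, [h'] is outside [A]; so [s] is not [h'], and the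
    differing lamp at [s] is visible in both labels. *)
Lemma wall_label_neq phi psi (h h' s : H) (A : set H) :
  wall A -> ~ A h -> A s -> s = h' \/ phi s <> psi s ->
  wall_label (phi, h) A <> wall_label (psi, h') A.
Proof.
move=> wA Ah As hs; rewrite /wall_label asboolT //= => -[].
rewrite (asboolF Ah) => /esym/asboolPn Ah' /(congr1 (@^~ s)).
rewrite (asboolT As) (asboolF Ah') /= => -[e].
by case: hs => // e'; apply: Ah'; rewrite -e'.
Qed.

End WreathDistance.

(** * Lipschitz bounds from edges to geodesics *)

Section PathLipschitz.
Context (R : realType) (G : graph) (D : G -> G -> R) (C : R).
Local Open Scope ring_scope.

Lemma path_lipschitz :
  (forall x, D x x = 0) -> (forall x y z, D x z <= D x y + D y z) ->
  (forall x y, adj x y -> D x y <= C) ->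
  forall x y, D x y <= C * (gd x y)%:R.
Proof.
move=> Dxx Dtri Dadj x y; have [p [xp <- <-]] := gd_geodesic x y.
elim: p x xp => [|z p IH] x /=; first by rewrite mulr0 Dxx.
move=> /andP[xz zp]; apply: le_trans (Dtri _ z _) _.
by rewrite -natr1 mulrDr mulr1 addrC lerD ?IH ?Dadj.
Qed.

End PathLipschitz.

(** * Walls separating two vertices of the wreath product *)

Section WreathWalls.
Context (G : graph) (one : G) (H : graph).
Local Notation W := (wreath one H).

Hypothesis med : forall x y z : H, exists m : H,
  [/\ between x m y, between y m z & between x m z].
Hypothesis medU : forall x y z m m' : H,
  between x m y -> between y m z -> between x m z ->
  between x m' y -> between y m' z -> between x m' z -> m = m'.

(** Labels can differ only at walls separating [h] from [h'] or from a site where the lamps differ.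
    [U] and [V] list these walls in their two orientations. *)
Lemma wall_labels_finite (x y : W) : exists2 s : seq (set H), uniq s &
  forall A, A \in s <-> wall_label x A <> wall_label y A.
Proof.
case: x y => [phi h] [psi h'].
have [s us sE] := finsupp_diff phi psi.
have [U UE] := choice (fun t => walls_between med medU h t).
have [V VE] := choice (fun t => walls_between med medU t h).
pose L := undup (flatten [seq U t ++ V t | t <- h' :: s]).
exists [seq A <- L | `[< wall_label (phi, h) A <> wall_label (psi, h') A >]].
  by rewrite filter_uniq // undup_uniq.
move=> A; rewrite mem_filter; split; first by move=> /andP[/asboolP].
move=> ne; apply/andP; split; first exact/asboolP.
have wA : wall A.
  by apply: contrapT => nA; apply: ne; rewrite /wall_label !(asboolF nA).
have [t tS At] : exists2 t, t \in h' :: s & ~ (A t <-> A h).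
  apply: contrapT => no; apply: ne; apply: wall_label_ext.
    apply: contrapT => e; apply: no; exists h'; first exact: mem_head.
    exact: (fun b => e (iff_sym b)).
  move=> k Ak; apply: contrapT => /sE ks; apply: no; exists k => //.
  by rewrite inE ks orbT.
rewrite mem_undup; apply/flattenP; exists (U t ++ V t).
  exact: (map_f (fun t => U t ++ V t) tS).
rewrite mem_cat; apply/orP.
have [_ _ Ut] := UE t; have [_ _ Vt] := VE t.
have [a|a] := pselect (A h); [left; apply/Ut|right; apply/Vt]; split => //.
- by move=> b; apply: At; split.
- by apply: contrapT => b; apply: At; split.
Qed.

Variable delta : nat.
Hypothesis hyp : forall x y z w : H,
  gd x y + gd z w <= maxn (gd x z + gd y w) (gd x w + gd y z) + delta.
Variable N : nat.
Hypothesis degN : degree_le H N.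

(** The route is a closed walk through the union of intervals [K], which visits every differing
    site, followed by a geodesic from [h] to [h']. *)
Lemma wreath_dist_le : exists B,
  forall (x y : W) (s1 : seq H) (s2 : seq (set H)),
  uniq s1 -> (forall k, x.1 k <> y.1 k -> k \in s1) ->
  uniq s2 -> (forall A, wall_label x A <> wall_label y A -> A \in s2) ->
  gd x y <= \sum_(k <- s1) gd (x.1 k) (y.1 k) + B * size s2.
Proof.
have [B BE] := hull_card med medU hyp degN.
(* The closed walk has length at most [2 * B * size s2], the geodesic at most [size s2]. *)
exists (2 * B).+1 => -[phi h] [psi h'] s1 s2 /= us1 s1E us2 s2E.
have [s us sE] := finsupp_diff phi psi.
have [|K [uK KE Ks]] := BE h (h' :: s) s2.
  move=> A t wA tS Ah At; apply: s2E; apply: (wall_label_neq wA Ah At).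
  by move: tS; rewrite inE => /orP[/eqP|/sE]; [left|right].
have hK : h \in K by apply/KE; left.
have [|p [hp ph Kp ps]] := closed_walk uK hK.
  move=> u v /KE[->|[t tS hut]] huv; apply/KE.
    left; apply: gd_eq0; move: huv; rewrite /between gdxx.
    by rewrite (gdC v); lia.
  right; exists t => //; move: huv hut; rewrite /between.
  by have := gd_triangle v u t; have := gd_triangle h v t; lia.
have [q [hq qh' qs]] := gd_geodesic h h'.
have hh' : gd h h' <= size s2.
  have [t [ut ts tE]] := walls_between med medU h' h.
  rewrite gdC -ts; apply: uniq_leq_size => // A /tE[wA Ah' Ah]; apply: s2E.
  by apply: (wall_label_neq wA Ah Ah'); left.
have hpq : path (@adj H) h (p ++ q) by rewrite cat_path hp ph.
have := @wreath_walk_dist _ _ _ phi psi s1 (p ++ q) h us1 s1E hpq.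
rewrite last_cat ph qh' size_cat qs => dist.
apply: leq_trans (dist _) _; last by lia.
move=> k /sE ks; have : k \in h :: p.
  apply: Kp; apply/KE; right; exists k; first by rewrite inE ks orbT.
  by rewrite /between gdxx addn0.
by rewrite !inE mem_cat => /orP[->|->]; rewrite ?orbT.
Qed.

End WreathWalls.

(** * Degree bounds and the embedding of the wreath product *)

Lemma uniformly_locally_finite_seq (H : graph) : uniformly_locally_finite H ->
  exists N, degree_le H N.
Proof.
move=> [N HN]; exists N => x.
have fin : finite_set [set y | adj x y] by apply: card_le_finite (HN x) _.
exists (finmap.enum_fset (fset_set [set y | adj x y])); split.
  exact: geq_card_fset_set.
by move=> y xy; have := in_fset_set fin y; rewrite mem_set.
Qed.

Theorem theorem1p6 (R : realType) (G H : graph) (one : G) :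
  uniformly_locally_finite H ->
  median_graph R H ->
  hyperbolic_graph R H ->
  bilipschitz_embeds_in_L1 (@graph_dist R G) ->
  bilipschitz_embeds_in_L1 (@graph_dist R (wreath one H)).
Proof.
move=> /uniformly_locally_finite_seq[N degN] medH.
have med := median_graph_ex medH; have medU := median_graph_uniq medH.
move=> /hyperbolic_graph_four_points[delta hyp].
move=> [d [T [mu [f [C C1 fC]]]]].
(* If the wreath product has no vertex, any map will do; otherwise [x0] is the base vertex of the
   construction. *)
have [[x0 _]|noW] := pselect (exists x : wreath one H, True); last first.
  exists d, T, mu, (fun=> f one), C => // x; exfalso.
  by apply: noW; exists x.
have [B distB] := wreath_dist_le one med medU hyp degN.
pose g (x : wreath one H) (k : H) := f (x.1 k).
have [||d' [T' [mu' [F FE]]]] :=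
    @L1_lamps_cuts R H (set H) _ _ x0 d T mu g (@wall_label G one H).
- move=> x; have [s _ sE] := finsupp_diff x.1 x0.1; exists s => k ks.
  by rewrite /g; congr f; apply: contrapT => /sE; exact/negP.
- move=> x; have [s _ sE] := wall_labels_finite med medU x x0; exists s => A As.
  by apply: contrapT => /sE; exact/negP.
have C0 : (0 < C)%R by apply: lt_le_trans C1; exact: ltr01.
(* A lamp move costs at most [C], and a lamplighter step costs 4, from two walls with two atoms
   each. The lower bound uses [C] for lamps and [B] for walls. *)
exists d', T', mu', F; exists (C + 4 + B%:R)%R.
  by apply: (le_trans C1); rewrite -addrA lerDl addr_ge0 ?ler0n.
move=> x y; rewrite !graph_distE; split; last first.
  apply: (@path_lipschitz R _ (fun u v => L1_dist (F u) (F v))) =>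
    [z|u v w|[phi h] [psi h'] uv].
  - exact: L1_dist_xx.
  - exact: L1_dist_triangle.
  have B0 : (0 <= B%:R :> R)%R by exact: ler0n.
  move/asboolP : (uv) => /= [[e hh']|[e phipsi hadj]].
    subst psi; have h'h : adj h' h by rewrite adj_sym.
    have hs : side h h' h by rewrite /side /= gdxx (gd_adj hh').
    have h's : ~ side h h' h' by rewrite /side /= gdxx.
    have ks : side h' h h' by rewrite /side /= gdxx (gd_adj h'h).
    have k's : ~ side h' h h by rewrite /side /= gdxx.
    (* No lamp changes, and the labels change exactly at the two orientations of the crossed
       edge. *)
    rewrite (FE _ _ [::] [:: side h h'; side h' h]) //=.
    + by rewrite big_nil; lra.
    + by rewrite inE andbT; apply/negP => /eqP e; apply: h's; rewrite e.
    + move=> A; rewrite !inE; split.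
        move=> /orP[]/eqP-> /esym.
          have wA := wall_side med medU hh'.
          by apply: (wall_label_neq wA h's hs); left.
        have wA := wall_side med medU h'h => /esym.
        by apply: (wall_label_neq wA k's ks); left.
      move=> /wall_label_move[wA [[a b]|[a b]]]; apply/orP;
        [left|right]; apply/eqP; exact: wall_edge wA _ a b.
  rewrite /= in e; subst h'.
  rewrite (FE _ _ [:: h] [::]) //=.
  + rewrite big_cons big_nil !addr0 /g /=.
    have [_] := fC (phi h) (psi h); rewrite graph_distE (gd_adj hadj) mulr1.
    by move=> le; apply: (le_trans le); lra.
  + by move=> k; rewrite inE => /eqP/phipsi; rewrite /g /= => ->.
  + by move=> A; split => // ne; exfalso; apply: ne; exact: wall_label_lamp.
have [s1 us1 s1E] := finsupp_diff x.1 y.1.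
have [s2 us2 s2E] := wall_labels_finite med medU x y.
rewrite (FE x y s1 s2) //; last first.
  by move=> k ks; rewrite /g; congr f; apply: contrapT => /s1E; exact/negP.
have := distB x y s1 s2 us1 (fun k => (s1E k).2) us2 (fun A => (s2E A).2).
rewrite -(ler_nat R) natrD natrM natr_sum => dxy.
rewrite mulrC ler_pdivrMr; last by rewrite -addrA addr_gt0 // addr_ge0 ?ler0n.
have S : (\sum_(k <- s1) (gd (x.1 k) (y.1 k))%:R <=
    C * \sum_(k <- s1) L1_dist (g x k) (g y k) :> R)%R.
  rewrite mulr_sumr; apply: ler_sum => k _.
  have [+ _] := fC (x.1 k) (y.1 k); rewrite graph_distE mulrC ler_pdivrMr //.
  by rewrite mulrC.
have S0 : (0 <= \sum_(k <- s1) L1_dist (g x k) (g y k) :> R)%R.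
  by apply: sumr_ge0 => k _; exact: L1_dist_ge0.
have n0 : (0 <= (size s2)%:R :> R)%R by exact: ler0n.
have B0 : (0 <= B%:R :> R)%R by exact: ler0n.
by apply: (le_trans dxy); move: S S0 n0 B0; rewrite natrM; nra.
Qed.
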